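(* Let $g=\begin{pmatrix}a&b\\c&d\end{pmatrix}\in\operatorname{PSL}_2(\mathbb{C}_n)$ with $c\neq 0$. Then the horosphere $g^{-1}(S_\infty)\subset\mathcal{H}^{n+1}$ is the Euclidean sphere with center $$p=\frac{1}{|c|^2}\left(-\bar c d-\frac{i_n}{2}(c^*b-a^*d)\right)$$ and radius $r=\frac{1}{2|c|^2}$. In particular, if $g\in\operatorname{PSL}_2(O)$ then the curvature $1/r$ of this sphere is an integer.
   Context: $\mathbb{C}_m$ is the real algebra generated by $i_1,\dots,i_{m-1}$ with $i_a^2=-1$, $i_ai_b=-i_bi_a$ ($a\neq b$); $\mathbb{C}_n\subset\mathbb{C}_{n+1}$. $V_m=\{x_0+x_1i_1+\cdots+x_{m-1}i_{m-1}\}$ with $|x|^2=\sum x_j^2$. Involutions: $x'$ (automorphism, $i_a\mapsto-i_a$), $x^*$ (anti-automorphism fixing each $i_a$), $\bar x=(x')^*$. The Clifford group $\Gamma_n$ is generated by nonzero elements of $V_n$; for $x\in\Gamma_n$, $|x|^2=x\bar x$. $\operatorname{SL}_2(\mathbb{C}_n)$: matrices $\begin{pmatrix}a&b\\c&d\end{pmatrix}$ with entries in $\Gamma_n\cup\{0\}$, $ad^*-bc^*=1$, $ab^*,cd^*,c^*a,d^*b\in V_n$, acting on $V_{n+1}\cup\{\infty\}$ by $x\mapsto(ax+b)(cx+d)^{-1}$ and preserving $\mathcal{H}^{n+1}=\{x\in V_{n+1}:x_n>0\}$; $\operatorname{PSL}_2=\operatorname{SL}_2/\{\pm1\}$. $S_\infty=\{x\in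 V_{n+1}: x_n=1\}$. For the last sentence: $O$ is an order (subring which is a full $\mathbb{Z}$-lattice), closed under $*$, in $K=\mathbb{Q}[\sqrt{d_1}i_1,\dots,\sqrt{d_{n-1}}i_{n-1}]\subset\mathbb{C}_n$ with $d_j$ squarefree positive integers such that $d_1y_1^2+\cdots+d_{n-1}y_{n-1}^2$ is primitive, and $\operatorname{SL}_2(O)$ consists of $g\in\operatorname{SL}_2(\mathbb{C}_n)$ with $g,g^{-1}$ having entries in $O$. *)

(* Defs.v *)
From HB Require Import structures.
From mathcomp Require Import all_boot all_order all_algebra.
From mathcomp Require Import ring.
From mathcomp Require Import boolp classical_sets reals.

Set Implicit Arguments.
Unset Strict Implicit.
Unset Printing Implicit Defensive.

Import Order.TTheory GRing.Theory Num.Theory.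
Local Open Scope ring_scope.

(* C_m has generators i_1, ..., i_{m-1}; a : 'I_m.-1 stands for i_{a+1}.  An
   element of C_m is the family of its coefficients on the basis of the products
   e_A = i_{a_1+1} ... i_{a_r+1}, for A = {a_1 < ... < a_r}. *)

Definition clifford (R : realType) (m : nat) : Type :=
  {ffun {set 'I_m.-1} -> R}.

Section CliffordAlgebra.
Variables (R : realType) (m : nat).
Local Notation I := {set 'I_m.-1}.
Local Notation C := (clifford R m).
Implicit Types (A B D : I) (x y z : C).

HB.instance Definition _ := GRing.Lmodule.copy C {ffun I -> R^o}.

Definition symdiff A B : I := [set a | (a \in A) (+) (a \in B)]%SET.

(* In e_A e_B, each pair a > b (a in A, b in B) costs a transposition and each
   common generator squares to -1; hence e_A e_B = (-1)^swaps e_{A symdiff B}. *)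
Definition swaps A B : nat := (\sum_(a in A) \sum_(b in B) (b <= a))%N.

Definition clifford_sign A B : R := (-1) ^+ swaps A B.

Definition blade A : C := [ffun B => (B == A)%:R].

Definition clifford_mul x y : C :=
  [ffun D => \sum_A clifford_sign A (symdiff A D) * (x A * y (symdiff A D))].

Lemma in_symdiff A B a : (a \in symdiff A B) = (a \in A) (+) (a \in B).
Proof. by rewrite inE. Qed.

Lemma symdiffA : associative symdiff.
Proof. by move=> A B D; apply/setP=> a; rewrite !in_symdiff addbA. Qed.

Lemma symdiffC : commutative symdiff.
Proof. by move=> A B; apply/setP=> a; rewrite !in_symdiff addbC. Qed.

Lemma symdiffK A : involutive (symdiff A).
Proof. by move=> B; apply/setP=> a; rewrite !in_symdiff addKb. Qed.

Lemma symdiff0 A : symdiff A finset.set0 = A.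
Proof. by apply/setP=> a; rewrite in_symdiff finset.in_set0 addbF. Qed.

Lemma symdiff0s A : symdiff finset.set0 A = A.
Proof. by rewrite symdiffC symdiff0. Qed.

Lemma prod_symdiff A B (f : 'I_m.-1 -> nat) :
  \prod_(a in symdiff A B) ((-1) ^+ f a : R) =
  (\prod_(a in A) (-1) ^+ f a) * \prod_(a in B) (-1) ^+ f a.
Proof.
rewrite big_mkcond [X in _ = X * _]big_mkcond [X in _ = _ * X]big_mkcond.
rewrite -big_split /=; apply: eq_bigr => a _; rewrite in_symdiff.
by do 2![case: (_ \in _)] => /=; rewrite ?mul1r ?mulr1 // -expr2 sqrr_sign.
Qed.

Lemma signr_sum (T : finType) (P : pred T) (f : T -> nat) :
  (-1 : R) ^+ (\sum_(a | P a) f a)%N = \prod_(a | P a) (-1) ^+ f a.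
Proof. by rewrite (big_morph _ (exprD _) (expr0 _)). Qed.

Lemma clifford_signDl A B D :
  clifford_sign (symdiff A B) D = clifford_sign A D * clifford_sign B D.
Proof. by rewrite /clifford_sign !signr_sum prod_symdiff. Qed.

Lemma clifford_signDr A B D :
  clifford_sign D (symdiff A B) = clifford_sign D A * clifford_sign D B.
Proof.
rewrite /clifford_sign /swaps ![(\sum_(a in D) _)%N]exchange_big /=.
by rewrite !signr_sum prod_symdiff.
Qed.

Lemma clifford_sign0l A : clifford_sign finset.set0 A = 1.
Proof. by rewrite /clifford_sign /swaps big_set0. Qed.

Lemma clifford_sign0r A : clifford_sign A finset.set0 = 1.
Proof. by rewrite /clifford_sign /swaps big1 // => a _; rewrite big_set0. Qed.

Lemma clifford_mulDl : left_distributive clifford_mul +%R.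
Proof.
move=> x y z; apply/ffunP=> D; rewrite !ffunE -big_split /=.
by apply: eq_bigr => A _; rewrite !ffunE mulrDl mulrDr.
Qed.

Lemma clifford_mulDr : right_distributive clifford_mul +%R.
Proof.
move=> x y z; apply/ffunP=> D; rewrite !ffunE -big_split /=.
by apply: eq_bigr => A _; rewrite !ffunE !mulrDr.
Qed.

Lemma clifford_mul1 : left_id (blade finset.set0) clifford_mul.
Proof.
move=> x; apply/ffunP=> D; rewrite ffunE (bigD1 finset.set0) //= big1 => [|A nA].
  by rewrite addr0 ffunE eqxx clifford_sign0l symdiff0s !mul1r.
by rewrite ffunE (negPf nA) mul0r mulr0.
Qed.

Lemma clifford_mulr1 : right_id (blade finset.set0) clifford_mul.
Proof.
move=> x; apply/ffunP=> D; rewrite ffunE (bigD1 D) //= big1 => [|A nA].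
  rewrite addr0 ffunE -[X in symdiff D X]symdiff0 symdiffK eqxx.
  by rewrite clifford_sign0r mulr1 mul1r.
rewrite ffunE; case: eqP => [AD|_]; last by rewrite !mulr0.
by move: nA; rewrite -[D](symdiffK A) AD symdiff0 eqxx.
Qed.

Lemma clifford_mulA : associative clifford_mul.
Proof.
move=> x y z; apply/ffunP=> D; rewrite !ffunE.
under eq_bigr => A _ do rewrite ffunE !mulr_sumr.
under [in RHS]eq_bigr => A _ do rewrite ffunE mulr_suml mulr_sumr.
rewrite [RHS]exchange_big /=; apply: eq_bigr => A _.
rewrite [RHS](reindex_inj (can_inj (symdiffK A))) /=.
apply: eq_bigr => B _; rewrite symdiffK.
have -> : symdiff (symdiff A B) D = symdiff B (symdiff A D).
  by rewrite [symdiff A B]symdiffC -symdiffA.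
set E := symdiff B (symdiff A D).
have -> : clifford_sign A (symdiff A D) = clifford_sign A B * clifford_sign A E.
  by rewrite -clifford_signDr /E symdiffK.
rewrite clifford_signDl; ring.
Qed.

Lemma blade0_neq0 : blade finset.set0 != 0.
Proof.
by apply/eqP=> /ffunP/(_ finset.set0)/eqP; rewrite !ffunE eqxx oner_eq0.
Qed.

HB.instance Definition _ := GRing.Zmodule_isNzRing.Build C
  clifford_mulA clifford_mul1 clifford_mulr1 clifford_mulDl clifford_mulDr
  blade0_neq0.

Lemma clifford_scaleAl (k : R) x y : k *: (x * y) = (k *: x) * y.
Proof.
apply/ffunP=> D; rewrite !ffunE scaler_sumr; apply: eq_bigr => A _.
by rewrite ffunE /GRing.scale /=; ring.
Qed.

Lemma clifford_scaleAr (k : R) x y : k *: (x * y) = x * (k *: y).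
Proof.
apply/ffunP=> D; rewrite !ffunE scaler_sumr; apply: eq_bigr => A _.
by rewrite ffunE /GRing.scale /=; ring.
Qed.

HB.instance Definition _ :=
  GRing.Lmodule_isLalgebra.Build R C clifford_scaleAl.
HB.instance Definition _ :=
  GRing.Lalgebra_isAlgebra.Build R C clifford_scaleAr.

Lemma clifford_mulE x y D :
  (x * y) D = \sum_A clifford_sign A (symdiff A D) * (x A * y (symdiff A D)).
Proof. by rewrite ffunE. Qed.

Lemma bladeM A B : blade A * blade B = clifford_sign A B *: blade (symdiff A B).
Proof.
apply/ffunP=> D; rewrite clifford_mulE (bigD1 A) //= big1 => [|E nE]; last first.
  by rewrite [blade A E]ffunE (negPf nE) mul0r mulr0.
rewrite addr0 !ffunE eqxx mul1r.
have -> : (symdiff A D == B) = (D == symdiff A B).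
  by rewrite -(inj_eq (can_inj (symdiffK A))) symdiffK.
by case: eqP => [->|_]; rewrite ?symdiffK // /GRing.scale /= !mulr0.
Qed.

(* C_m is noncommutative: its unit ring structure is obtained classically, the
   units being the elements with a two-sided inverse. *)
Definition clifford_inv_set x : set C := [set y | y * x = 1 /\ x * y = 1]%classic.
Definition clifford_unit : pred C := fun x => `[< exists y, clifford_inv_set x y >].
Definition clifford_inv x : C := xget x (clifford_inv_set x).

Lemma clifford_invP x : clifford_unit x -> clifford_inv_set x (clifford_inv x).
Proof. by move=> /asboolP[y xy]; apply: (xgetPex _ (ex_intro _ y xy)). Qed.

Lemma clifford_mulVr : {in clifford_unit, left_inverse 1 clifford_inv *%R}.
Proof. by move=> x /clifford_invP[]. Qed.

Lemma clifford_mulrV : {in clifford_unit, right_inverse 1 clifford_inv *%R}.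
Proof. by move=> x /clifford_invP[]. Qed.

Lemma clifford_unitP x y : y * x = 1 /\ x * y = 1 -> clifford_unit x.
Proof. by move=> xy; apply/asboolP; exists y. Qed.

Lemma clifford_inv_out : {in [predC clifford_unit], clifford_inv =1 id}.
Proof.
move=> x; rewrite inE => /negP xU; apply: xgetPN => y xy.
by apply: xU; apply: clifford_unitP xy.
Qed.

HB.instance Definition _ := GRing.NzRing_hasMulInverse.Build C
  clifford_mulVr clifford_mulrV clifford_unitP clifford_inv_out.

(* For 0 < j < m this is {j-1}, the index of i_j; for j = 0 it is empty, so that
   [cl_gen 0] is 1 and [cl_coord 0 x] is the scalar coefficient x_0. *)
Definition cl_gen_index (j : nat) : I := [set a : 'I_m.-1 | a.+1 == j]%SET.

Definition cl_gen (j : nat) : C := blade (cl_gen_index j).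

Definition cl_coord (j : nat) x : R := x (cl_gen_index j).

Lemma cl_gen0 : cl_gen 0 = 1.
Proof. by congr blade; apply/setP=> a; rewrite !inE. Qed.

Lemma cl_gen_indexE (a : 'I_m.-1) : cl_gen_index a.+1 = [set a]%SET.
Proof. by apply/setP=> b; rewrite !inE eqSS. Qed.

Lemma cl_gen_sqr j : (0 < j < m)%N -> cl_gen j * cl_gen j = -1.
Proof.
case: j => // j /= ltjm; have jm : (j < m.-1)%N by move: ltjm; case: (m).
rewrite /cl_gen (cl_gen_indexE (Ordinal jm)) bladeM /clifford_sign /swaps !big_set1 /=.
rewrite leqnn expr1 scaleN1r; congr (- blade _).
by apply/setP=> a; rewrite in_symdiff addbb inE.
Qed.

Lemma cl_gen_anticomm j l : (0 < j < m)%N -> (0 < l < m)%N -> j != l ->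
  cl_gen j * cl_gen l = - (cl_gen l * cl_gen j).
Proof.
case: j l => // j [//|l] /= ltjm ltlm; rewrite eqSS => njl.
have jm : (j < m.-1)%N by move: ltjm; case: (m).
have lm : (l < m.-1)%N by move: ltlm; case: (m).
rewrite /cl_gen (cl_gen_indexE (Ordinal jm)) (cl_gen_indexE (Ordinal lm)) !bladeM.
rewrite [symdiff [set Ordinal lm]%SET _]symdiffC -scaleNr.
rewrite /clifford_sign /swaps !big_set1 /=; congr (_ *: _).
by case: ltngtP njl => // _ _; rewrite ?expr1 ?expr0 ?opprK.
Qed.

Definition cl_prime x : C := [ffun A : I => (-1) ^+ #|A| * x A].

(* Reversing the r factors of a blade takes r(r-1)/2 transpositions. *)
Definition cl_star x : C := [ffun A : I => (-1) ^+ 'C(#|A|, 2) * x A].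

Definition cl_bar x : C := cl_star (cl_prime x).

Lemma swapsAA A : swaps A A = 'C(#|A|.+1, 2).
Proof.
have H : (swaps A A + swaps A A = #|A| * #|A| + #|A|)%N.
  rewrite {2}/swaps exchange_big /= -big_split /= -sum1_card big_distrl /=.
  rewrite -big_split /=; apply: eq_bigr => a aA.
  rewrite mul1n -big_split /= [in RHS](bigD1 a aA) [in LHS](bigD1 a aA) /= leqnn.
  rewrite (eq_bigr (fun=> 1%N)) ?addnA 1?addnAC // => b /andP[_ nba].
  by case: ltngtP nba => // /val_inj ->; rewrite eqxx.
apply: double_inj; rewrite -addnn H -mul2n mul_bin_left bin1 subSS subn0.
by rewrite mulnSr.
Qed.

Lemma cl_barE x A : cl_bar x A = clifford_sign A A * x A.
Proof.
rewrite !ffunE mulrA -exprD /clifford_sign swapsAA; congr (_ ^+ _ * _).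
by rewrite binS bin1 addnC.
Qed.

Lemma signr_card_symdiff A B :
  (-1 : R) ^+ #|symdiff A B| = (-1) ^+ #|A| * (-1) ^+ #|B|.
Proof. by rewrite -!sum1_card !signr_sum prod_symdiff. Qed.

Lemma cl_primeM : {morph cl_prime : x y / x * y}.
Proof.
move=> x y; apply/ffunP=> D; rewrite ffunE !clifford_mulE mulr_sumr.
apply: eq_bigr => A _; rewrite !ffunE -{1}[D](symdiffK A) signr_card_symdiff.
by ring.
Qed.

Lemma cl_barM x y : cl_bar (x * y) = cl_bar y * cl_bar x.
Proof.
apply/ffunP=> D; rewrite cl_barE !clifford_mulE mulr_sumr.
rewrite [RHS](reindex_inj (can_inj (symdiffK D))) /=.
apply: eq_bigr => A _; rewrite [symdiff D A]symdiffC.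
set B := symdiff A D.
have -> : symdiff B D = A by rewrite /B symdiffC [symdiff A D]symdiffC symdiffK.
have -> : D = symdiff A B by rewrite /B symdiffK.
move: B => B.
rewrite !cl_barE clifford_signDl !clifford_signDr.
have sAB : clifford_sign A B * clifford_sign A B = 1.
  by rewrite -expr2 sqrr_sign.
set s := clifford_sign A B in sAB *; set t := clifford_sign B A.
transitivity ((s * s) * (clifford_sign A A * t * clifford_sign B B * (x A * y B))).
  by ring.
by rewrite sAB; ring.
Qed.

Lemma cl_primeK : involutive cl_prime.
Proof.
by move=> x; apply/ffunP=> A; rewrite !ffunE mulrA -expr2 sqrr_sign mul1r.
Qed.

Lemma cl_starE x : cl_star x = cl_bar (cl_prime x).
Proof. by rewrite /cl_bar cl_primeK. Qed.

Lemma cl_starM x y : cl_star (x * y) = cl_star y * cl_star x.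
Proof. by rewrite !cl_starE cl_primeM cl_barM. Qed.

Lemma card_gen_index j : (0 < j < m)%N -> #|cl_gen_index j| = 1.
Proof.
case: j => // j /= ltjm; have jm : (j < m.-1)%N by move: ltjm; case: (m).
by rewrite (cl_gen_indexE (Ordinal jm)) cards1.
Qed.

Lemma cl_star_gen j : (0 < j < m)%N -> cl_star (cl_gen j) = cl_gen j.
Proof.
move=> jm; apply/ffunP=> A; rewrite !ffunE.
by case: eqP => [->|_]; rewrite ?mulr0 // card_gen_index // mul1r.
Qed.

Lemma cl_prime_gen j : (0 < j < m)%N -> cl_prime (cl_gen j) = - cl_gen j.
Proof.
move=> jm; apply/ffunP=> A; rewrite !ffunE.
by case: eqP => [->|_]; rewrite ?mulr0 ?oppr0 // card_gen_index // mulr1.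
Qed.

(* V_k, Gamma_k and SL_2(C_k) are taken inside C_m for k <= m, through the
   inclusion of C_k in C_m. *)

Definition Vsp (k : nat) : set C :=
  [set x | exists t : nat -> R, x = \sum_(j < k) t j *: cl_gen j]%classic.

Definition Vnorm (k : nat) x : R := Num.sqrt (\sum_(j < k) cl_coord j x ^+ 2).

Inductive Gamma (k : nat) : C -> Prop :=
| Gamma_vec x : Vsp k x -> x != 0 -> Gamma k x
| Gamma_one : Gamma k 1
| Gamma_mul x y : Gamma k x -> Gamma k y -> Gamma k (x * y)
| Gamma_inv x : Gamma k x -> Gamma k x^-1.

(* |x|^2 = x * cl_bar x for x in a Clifford group; that product is then a scalar,
   read off here as its coefficient on 1. *)
Definition normsq x : R := cl_coord 0 (x * cl_bar x).

Local Notation M2 := 'M[C]_2.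
Implicit Types g h : M2.

Definition SL2 (k : nat) : set M2 :=
  [set g | let a := g 0 0 in let b := g 0 1 in
           let c := g 1 0 in let d := g 1 1 in
    [/\ forall i j, Gamma k (g i j) \/ g i j = 0,
        a * cl_star d - b * cl_star c = 1,
        Vsp k (a * cl_star b) /\ Vsp k (c * cl_star d) &
        Vsp k (cl_star c * a) /\ Vsp k (cl_star d * b)]]%classic.

Definition mx_inverse g h : Prop := g *m h = 1%:M /\ h *m g = 1%:M.

(* V_m together with oo sits in [option C], [None] being oo. *)
Definition mobius g (x : option C) : option C :=
  let a := g 0 0 in let b := g 0 1 in let c := g 1 0 in let d := g 1 1 in
  match x with
  | Some x => if c * x + d == 0 then None
              else Some ((a * x + b) * (c * x + d)^-1)
  | None => if c == 0 then None else Some (a * c^-1)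
  end.

Lemma mobiusN g (x : option C) : mobius (- g) x = mobius g x.
Proof.
case: x => [x|] /=; rewrite !mxE.
  by rewrite !mulNr -!opprD oppr_eq0 invrN mulrNN.
by rewrite oppr_eq0 invrN mulrNN.
Qed.

(* Quotient by {1, -1}: an element of PSL_2 is a class {g, -g}. *)
Definition proj_classes (S : set M2) : set (set M2) :=
  [set [set g; - g] | g in S]%classic.

Definition PSL2 (k : nat) : set (set M2) := proj_classes (SL2 k).

Definition class_inv (G : set M2) : set M2 :=
  [set h | exists2 g, G g & mx_inverse g h]%classic.

(* Well defined on classes by [mobiusN]. *)
Definition class_act (G : set M2) (X : set (option C)) : set (option C) :=
  [set mobius g x | g in G & x in X]%classic.

(* Q[sqrt(d_1) i_1, ..., sqrt(d_{k-1}) i_{k-1}] *)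
Inductive Kalg (k : nat) (ds : nat -> nat) : C -> Prop :=
| Kalg_rat (q : rat) : Kalg k ds (ratr q)%:A
| Kalg_gen j : (0 < j < k)%N -> Kalg k ds (Num.sqrt (ds j)%:R *: cl_gen j)
| Kalg_add x y : Kalg k ds x -> Kalg k ds y -> Kalg k ds (x + y)
| Kalg_mul x y : Kalg k ds x -> Kalg k ds y -> Kalg k ds (x * y).

Definition full_lattice (K O : set C) : Prop :=
  exists (r : nat) (b : 'I_r -> C),
  [/\ forall q : 'I_r -> rat,
        \sum_i ratr (q i) *: b i = 0 -> forall i, q i = 0,
      K = [set x | exists q : 'I_r -> rat, x = \sum_i ratr (q i) *: b i]%classic &
      O = [set x | exists z : 'I_r -> int, x = \sum_i b i *~ z i]%classic].

Definition is_order (K O : set C) : Prop :=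
  [/\ O 1, forall x y, O x -> O y -> O (x - y),
      forall x y, O x -> O y -> O (x * y) & full_lattice K O].

Definition SL2_order (k : nat) (O : set C) : set M2 :=
  [set g | [/\ SL2 k g, forall i j, O (g i j) &
               exists2 h, mx_inverse g h & forall i j, O (h i j)]]%classic.

Definition PSL2_order (k : nat) (O : set C) : set (set M2) :=
  proj_classes (SL2_order k O).

End CliffordAlgebra.

Definition squarefree (d : nat) : Prop := forall q, prime q -> ~~ (q ^ 2 %| d)%N.

(* The form d_1 y_1^2 + ... + d_{k-1} y_{k-1}^2 is primitive if its coefficients
   have gcd 1; the empty form (k = 1, K = Q) carries no condition. *)
Definition primitive_form (k : nat) (ds : nat -> nat) : Prop :=
  (1 < k)%N -> (\big[gcdn/0]_(1 <= j < k) ds j = 1)%N.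

Section HalfSpace.
Variables (R : realType) (n : nat).
Local Notation C := (clifford R n.+1).

Definition upper_half : set C := [set x | Vsp n.+1 x /\ 0 < cl_coord n x]%classic.

Definition S_infty : set C := [set x | Vsp n.+1 x /\ cl_coord n x = 1]%classic.

Definition euclidean_sphere (p : C) (r : R) : set C :=
  [set x | Vsp n.+1 x /\ Vnorm n.+1 (x - p) = r]%classic.

End HalfSpace.

Arguments upper_half R n : clear implicits.
Arguments S_infty R n : clear implicits.

(* Main.v *)
(* Write N = |c|^2.  The second determinant relation a^* d - c^* b = 1 reduces the
   centre to p = - c^-1 d + i_n / (2N), and the inverse of g acts by
   x |-> - c^-1 d - c^-1 (x - a c^-1)^-1 (c^-1)^*.  For gamma in Gamma_n the map
   x |-> gamma x gamma^* preserves V_{n+1}, multiplies x_n by |gamma|^2 and |x|^2 by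
   |gamma|^4.  Hence, with w = y + c^-1 d, the image of {x_n = 1} is the set
   N |w|^2 = w_n, w != 0, which is the sphere minus the image - c^-1 d of infinity.
   For the curvature 2N: left and right multiplication by c preserve the order O, so
   they have integral determinants, whose product is N^(dim K); as N is rational, it
   is an integer. *)

Require Import Defs.
From HB Require Import structures.
From mathcomp Require Import all_boot all_order all_algebra.
From mathcomp Require Import ring.
From mathcomp Require Import boolp classical_sets reals.

Import Order.TTheory GRing.Theory Num.Theory.
Local Open Scope ring_scope.
Local Open Scope classical_set_scope.

Set Implicit Arguments.
Unset Strict Implicit.
Unset Printing Implicit Defensive.

(** * The three involutions of C_m: linearity, units, generators *)

Section Involutions.
Variables (R : realType) (m : nat).
Local Notation C := (clifford R m).
Implicit Types x y : C.

Lemma cl_star_is_linear : linear (@cl_star R m).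
Proof.
move=> k x y; apply/ffunP=> A; rewrite !ffunE !mulrDr.
by congr (_ + _); apply: mulrCA.
Qed.
HB.instance Definition _ :=
  GRing.isLinear.Build R C C *:%R (@cl_star R m) cl_star_is_linear.

Lemma cl_prime_is_linear : linear (@cl_prime R m).
Proof.
move=> k x y; apply/ffunP=> A; rewrite !ffunE !mulrDr.
by congr (_ + _); apply: mulrCA.
Qed.
HB.instance Definition _ :=
  GRing.isLinear.Build R C C *:%R (@cl_prime R m) cl_prime_is_linear.

Lemma cl_bar_is_linear : linear (@cl_bar R m).
Proof. by move=> k x y; rewrite /cl_bar !linearP. Qed.
HB.instance Definition _ :=
  GRing.isLinear.Build R C C *:%R (@cl_bar R m) cl_bar_is_linear.

Lemma cl_coord_is_scalar j : scalar (@cl_coord R m j).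
Proof. by move=> k x y; rewrite /cl_coord !ffunE. Qed.
HB.instance Definition _ j :=
  GRing.isLinear.Build R C R *%R (@cl_coord R m j) (cl_coord_is_scalar j).

Lemma cl_prime1 : cl_prime (1 : C) = 1.
Proof.
by apply/ffunP=> A; rewrite !ffunE; case: eqP => [->|_]; rewrite ?cards0 ?mulr0 ?mul1r.
Qed.

Lemma cl_star1 : cl_star (1 : C) = 1.
Proof.
by apply/ffunP=> A; rewrite !ffunE; case: eqP => [->|_]; rewrite ?cards0 ?mulr0 ?mul1r.
Qed.

Lemma cl_bar1 : cl_bar (1 : C) = 1.
Proof. by rewrite /cl_bar cl_prime1 cl_star1. Qed.

Lemma cl_starK : involutive (@cl_star R m).
Proof. by move=> x; apply/ffunP=> A; rewrite !ffunE mulrA -expr2 sqrr_sign mul1r. Qed.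

Lemma cl_prime_star x : cl_prime (cl_star x) = cl_bar x.
Proof. by apply/ffunP=> A; rewrite !ffunE mulrCA. Qed.

Lemma cl_barK : involutive (@cl_bar R m).
Proof. by move=> x; rewrite -[LHS]cl_prime_star cl_starK cl_primeK. Qed.

Lemma cl_bar_star x : cl_bar (cl_star x) = cl_prime x.
Proof. by rewrite -cl_prime_star cl_starK. Qed.

Lemma cl_primeV x : x \is a GRing.unit -> cl_prime x^-1 = (cl_prime x)^-1.
Proof.
move=> xU; have e1 : cl_prime x * cl_prime x^-1 = 1 by rewrite -cl_primeM divrr ?cl_prime1.
have e2 : cl_prime x^-1 * cl_prime x = 1 by rewrite -cl_primeM mulVr ?cl_prime1.
have xU' : cl_prime x \is a GRing.unit by apply/unitrP; exists (cl_prime x^-1).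
by rewrite -[LHS]mul1r -(mulVr xU') -mulrA e1 mulr1.
Qed.

Lemma cl_starV x : x \is a GRing.unit -> cl_star x^-1 = (cl_star x)^-1.
Proof.
move=> xU; have e1 : cl_star x * cl_star x^-1 = 1 by rewrite -cl_starM mulVr ?cl_star1.
have e2 : cl_star x^-1 * cl_star x = 1 by rewrite -cl_starM divrr ?cl_star1.
have xU' : cl_star x \is a GRing.unit by apply/unitrP; exists (cl_star x^-1).
by rewrite -[LHS]mul1r -(mulVr xU') -mulrA e1 mulr1.
Qed.

(** Both bounds matter: from index m on the index set is empty, so [cl_gen] degenerates to 1 and
    [cl_coord] to the scalar part. *)
Lemma cl_coord_gen j l : (j < m)%N -> (l < m)%N -> cl_coord j (cl_gen R m l) = (j == l)%:R.
Proof.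
move=> jm lm; rewrite /cl_coord ffunE; congr (nat_of_bool _)%:R.
apply/eqP/eqP => [|->//] /setP eqjl.
case: j l jm lm eqjl => [|j] [|l] //= jm lm eqjl.
- have lm' : (l < m.-1)%N by case: (m) lm.
  by have := eqjl (Ordinal lm'); rewrite !inE eqxx.
- have jm' : (j < m.-1)%N by case: (m) jm.
  by have := eqjl (Ordinal jm'); rewrite !inE eqxx.
- have jm' : (j < m.-1)%N by case: (m) jm.
  by have := eqjl (Ordinal jm'); rewrite !inE eqxx => /esym/eqP.
Qed.

Lemma cl_coord01 : cl_coord 0 (1 : C) = 1.
Proof. by rewrite -cl_gen0 /cl_coord ffunE eqxx. Qed.

Lemma cl_star_gen_all j : (j < m)%N -> cl_star (cl_gen R m j) = cl_gen R m j.
Proof. by case: j => [|j] jm; rewrite ?cl_gen0 ?cl_star1 // cl_star_gen. Qed.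

Lemma cl_bar_gen j : (0 < j < m)%N -> cl_bar (cl_gen R m j) = - cl_gen R m j.
Proof. by move=> jm; rewrite /cl_bar cl_prime_gen // linearN /= cl_star_gen. Qed.

End Involutions.

(** * Vectors: coordinates, squared norm, and x bar x *)

Section Vectors.
Variables (R : realType) (m : nat).
Local Notation C := (clifford R m).
Implicit Types x y v w : C.

(** The radicand of [Vnorm]; on vectors it is the scalar x bar x, the form in which norms are
    computed below. *)
Definition Vsqn (k : nat) x : R := \sum_(j < k) cl_coord j x ^+ 2.

Lemma Vsp0 k : Vsp k (0 : C).
Proof. by exists (fun=> 0); rewrite big1 // => j _; rewrite scale0r. Qed.

Lemma VspD k x y : Vsp k x -> Vsp k y -> Vsp k (x + y).
Proof.
move=> [s ->] [t ->]; exists (fun j => s j + t j); rewrite -big_split /=.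
by apply: eq_bigr => j _; rewrite scalerDl.
Qed.

Lemma VspZ k (r : R) x : Vsp k x -> Vsp k (r *: x).
Proof.
move=> [s ->]; exists (fun j => r * s j); rewrite scaler_sumr.
by apply: eq_bigr => j _; rewrite scalerA.
Qed.

Lemma VspN k x : Vsp k x -> Vsp k (- x).
Proof. by rewrite -scaleN1r; apply: VspZ. Qed.

Lemma VspB k x y : Vsp k x -> Vsp k y -> Vsp k (x - y).
Proof. by move=> Vx Vy; apply: VspD => //; apply: VspN. Qed.

Lemma Vsp_gen k j : (j < k)%N -> Vsp k (cl_gen R m j).
Proof.
move=> jk; exists (fun l => (l == j)%:R); rewrite (bigD1 (Ordinal jk)) //= eqxx scale1r.
by rewrite big1 ?addr0 // => l; rewrite -val_eqE /= => /negPf ->; rewrite scale0r.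
Qed.

Lemma Vsp1 k : (0 < k)%N -> Vsp k (1 : C).
Proof. by move=> k0; rewrite -cl_gen0; apply: Vsp_gen. Qed.

Lemma VspW k l x : (k <= l)%N -> Vsp k x -> Vsp l x.
Proof.
move=> kl [s ->]; elim/big_ind: _ => [|y z|j _]; [exact: Vsp0|exact: VspD|].
by apply: VspZ; apply: Vsp_gen; apply: leq_trans kl.
Qed.

Lemma Vsp_coordE k x : (k <= m)%N -> Vsp k x ->
  x = \sum_(j < k) cl_coord j x *: cl_gen R m j.
Proof.
move=> km [s Es]; rewrite {1}Es; apply: eq_bigr => j _; congr (_ *: _).
rewrite Es linear_sum /= (bigD1 j) //= linearZ /= cl_coord_gen ?(leq_trans _ km) //.
rewrite eqxx mulr1 big1 ?addr0 // => l nlj.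
rewrite linearZ /= cl_coord_gen ?(leq_trans _ km) //.
by rewrite val_eqE eq_sym (negPf nlj) mulr0.
Qed.

Lemma Vsp_coord_out k l x : (k <= l < m)%N -> Vsp k x -> cl_coord l x = 0.
Proof.
move=> /andP[kl lm] [s ->]; rewrite linear_sum big1 // => j _.
have jl := leq_trans (ltn_ord j) kl.
by rewrite linearZ /= cl_coord_gen ?(ltn_trans jl) // gtn_eqF // mulr0.
Qed.

Lemma Vsp_recr k x : (k < m)%N -> Vsp k.+1 x -> Vsp k (x - cl_coord k x *: cl_gen R m k).
Proof.
move=> km Vx; exists (fun j => cl_coord j x); rewrite {1}(Vsp_coordE km Vx).
by rewrite big_ord_recr /= addrK.
Qed.

Lemma cl_star_Vsp k x : (k <= m)%N -> Vsp k x -> cl_star x = x.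
Proof.
move=> km [s ->]; rewrite linear_sum; apply: eq_bigr => j _.
by rewrite linearZ /= cl_star_gen_all // (leq_trans _ km).
Qed.

(** On vectors [cl_bar] fixes the scalar part and negates each i_j, so x + bar x is twice the scalar
    part. *)
Lemma cl_bar_Vsp k x : (0 < k <= m)%N -> Vsp k x ->
  cl_bar x = (2 * cl_coord 0 x)%:A - x.
Proof.
move=> /andP[]; case: k => // k _ km Vx; rewrite {1 3}(Vsp_coordE km Vx) linear_sum.
rewrite !big_ord_recl /= cl_gen0 linearZ /= cl_bar1 opprD addrA -scalerBl.
rewrite mulr_natl mulr2n addrK -sumrN; congr (_ + _); apply: eq_bigr => j _.
rewrite linearZ /= cl_bar_gen ?scalerN //=.
by apply: leq_trans km; rewrite ltnS ltn_ord.
Qed.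

Lemma Vsp_bar k x : (0 < k <= m)%N -> Vsp k x -> Vsp k (cl_bar x).
Proof.
move=> km Vx; rewrite (cl_bar_Vsp km Vx); apply: VspB => //; apply: VspZ.
by apply: Vsp1; case/andP: km.
Qed.

(** The new generator anticommutes with all earlier ones, so in the induction the cross terms cancel
    and only its square -1 contributes. The shift [j.+1] skips index 0, which stands for 1. *)
Lemma imag_sqr k (t : nat -> R) : (k < m)%N ->
  let w := \sum_(j < k) t j *: cl_gen R m j.+1 in
  w * w = - (\sum_(j < k) t j ^+ 2)%:A.
Proof.
elim: k => [|k IH] km /=; first by rewrite !big_ord0 mul0r scale0r oppr0.
rewrite !big_ord_recr /=; have := IH (ltnW km); set w := \sum_(j < k) _ => /= ww.
have anti : w * cl_gen R m k.+1 = - (cl_gen R m k.+1 * w).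
  rewrite mulr_suml mulr_sumr -sumrN; apply: eq_bigr => j _.
  have jk := ltn_ord j.
  rewrite -scalerAl -scalerAr cl_gen_anticomm ?scalerN //=.
    by apply: (ltn_trans _ km).
  by rewrite eqSS ltn_eqF.
rewrite mulrDl !mulrDr ww -!scalerAl -!scalerAr anti scalerA scalerN.
by rewrite cl_gen_sqr // addrA subrK scalerN -opprD scalerDl expr2.
Qed.

(** With x = t + w, t scalar and w imaginary, x bar x = (t + w)(t - w) = t^2 - w^2, and [imag_sqr]
    evaluates w^2. *)
Lemma mul_bar_Vsp k x : (0 < k <= m)%N -> Vsp k x -> x * cl_bar x = (Vsqn k x)%:A.
Proof.
move=> km Vx; rewrite (cl_bar_Vsp km Vx); case/andP: km; case: k Vx => // k Vx _ km.
rewrite /Vsqn big_ord_recl /=; have := imag_sqr (fun j => cl_coord j.+1 x) km => /=.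
set w := \sum_(j < k) _ => ww.
have Ex : x = (cl_coord 0 x)%:A + w.
  by rewrite {1}(Vsp_coordE km Vx) big_ord_recl cl_gen0.
set t := cl_coord 0 x in Ex *; set S := \sum_(j < k) _ in ww *.
rewrite -/S; move: S ww => S ww; rewrite Ex.
rewrite mulr_natl mulr2n [(t + t)%:A]scalerDl opprD addrA addrK.
rewrite mulrDl !mulrBr ww opprK !mulr_algl mulr_algr scalerA addrA subrK.
by rewrite -scalerDl expr2.
Qed.

Lemma bar_mul_Vsp k x : (0 < k <= m)%N -> Vsp k x -> cl_bar x * x = (Vsqn k x)%:A.
Proof.
move=> km Vx; rewrite -(mul_bar_Vsp km Vx) (cl_bar_Vsp km Vx).
by rewrite mulrBl mulrBr mulr_algl mulr_algr.
Qed.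

Lemma Vsqn_ge0 k x : 0 <= Vsqn k x.
Proof. by apply: sumr_ge0 => j _; apply: sqr_ge0. Qed.

Lemma Vsqn_eq0 k x : (k <= m)%N -> Vsp k x -> Vsqn k x = 0 -> x = 0.
Proof.
move=> km Vx /eqP; rewrite psumr_eq0 => [/allP q0|j _]; last exact: sqr_ge0.
rewrite (Vsp_coordE km Vx) big1 // => j _.
by have := q0 j (mem_index_enum _); rewrite sqrf_eq0 => /eqP ->; rewrite scale0r.
Qed.

Lemma Vsqn_gt0 k x : (k <= m)%N -> Vsp k x -> x != 0 -> 0 < Vsqn k x.
Proof.
move=> km Vx x0; rewrite lt_def Vsqn_ge0 andbT; apply: contra_neq x0.
exact: Vsqn_eq0.
Qed.

(* Polarizing [mul_bar_Vsp] gives v x = 2<v, bar x> - bar x bar v, so that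
   v x v = 2<v, bar x> v - |v|^2 bar x. *)
Lemma Vsp_sandwich k v x : (0 < k <= m)%N -> Vsp k v -> Vsp k x -> Vsp k (v * x * v).
Proof.
move=> km Vv Vx; have Vy := Vsp_bar km Vx.
have := mul_bar_Vsp km (VspD Vv Vy).
rewrite linearD /= cl_barK mulrDl !mulrDr (mul_bar_Vsp km Vv).
rewrite (bar_mul_Vsp km Vx).
set a := Vsqn k _; set b := Vsqn k _; set c := Vsqn k _ => E.
have -> : v * x = (c - a - b)%:A - cl_bar x * cl_bar v.
  by apply/eqP; rewrite eq_sym !scalerBl !subr_eq -E -addrA addrC !addrA.
rewrite mulrBl -mulrA (bar_mul_Vsp km Vv) mulr_algl mulr_algr.
by apply: VspB; apply: VspZ.
Qed.

End Vectors.

(** * The Clifford group: norm, inverses, and the action w |-> x w x^* *)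

Section CliffordGroup.
Variables (R : realType) (m : nat).
Local Notation C := (clifford R m).
Implicit Types x y v w : C.

Lemma scale_mul_inv (x y : C) (r : R) : r != 0 -> x * y = r%:A -> y * x = r%:A ->
  x \is a GRing.unit /\ x^-1 = r^-1 *: y.
Proof.
move=> r0 xy yx.
have e1 : x * (r^-1 *: y) = 1 by rewrite -scalerAr xy scalerA mulVf // scale1r.
have e2 : (r^-1 *: y) * x = 1 by rewrite -scalerAl yx scalerA mulVf // scale1r.
have xU : x \is a GRing.unit by apply/unitrP; exists (r^-1 *: y).
by split=> //; rewrite -[LHS]mul1r -e2 -mulrA divrr // mulr1.
Qed.

Lemma Vsp_inv k x : (0 < k <= m)%N -> Vsp k x -> x != 0 ->
  x \is a GRing.unit /\ x^-1 = (Vsqn k x)^-1 *: cl_bar x.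
Proof.
move=> km Vx x0; apply: scale_mul_inv; last 2 first.
- exact: mul_bar_Vsp.
- exact: bar_mul_Vsp.
by rewrite gt_eqF // Vsqn_gt0 //; case/andP: km.
Qed.

Lemma normsqE x (r : R) : x * cl_bar x = r%:A -> normsq x = r.
Proof. by move=> xx; rewrite /normsq xx linearZ /= cl_coord01 mulr1. Qed.

Lemma Gamma_norm k x : (0 < k <= m)%N -> Gamma k x ->
  [/\ 0 < normsq x, x * cl_bar x = (normsq x)%:A & cl_bar x * x = (normsq x)%:A].
Proof.
move=> km Gx.
(* [normsq] reads off one coefficient, which says little about x bar x until that product is known
   to be scalar; the induction therefore carries an unnamed scalar r. Scalars being central, it
   passes to products and inverses. *)
suff [r [r0 xx xx']] : exists r : R, [/\ 0 < r, x * cl_bar x = r%:A & cl_bar x * x = r%:A].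
  by rewrite (normsqE xx).
elim: Gx => {x} [x Vx x0||x y _ [r [r0 rx rx']] _ [s [s0 sy sy']]|x _ [r [r0 rx rx']]].
- exists (Vsqn k x); split; [|exact: mul_bar_Vsp|exact: bar_mul_Vsp].
  by apply: Vsqn_gt0 => //; case/andP: km.
- by exists 1; rewrite cl_bar1 mulr1 scale1r.
- exists (r * s); rewrite mulr_gt0 // cl_barM !mulrA; split=> //.
    by rewrite -[x * y * _]mulrA sy mulr_algr -scalerAl rx scalerA mulrC.
  by rewrite -[cl_bar y * _ * _]mulrA rx' mulr_algr -scalerAl sy' scalerA.
- have [xU ->] := scale_mul_inv (lt0r_neq0 r0) rx rx'.
  exists r^-1; rewrite invr_gt0 linearZ /= cl_barK -!scalerAl -!scalerAr !scalerA rx rx'.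
  by rewrite scalerA -mulrA mulVf ?mulr1 // lt0r_neq0.
Qed.

Lemma Gamma_unit k x : (0 < k <= m)%N -> Gamma k x -> x \is a GRing.unit.
Proof.
move=> km /(Gamma_norm km)[r0 xx xx'].
by case: (scale_mul_inv (lt0r_neq0 r0) xx xx').
Qed.

Lemma Gamma_invE k x : (0 < k <= m)%N -> Gamma k x -> x^-1 = (normsq x)^-1 *: cl_bar x.
Proof.
move=> km /(Gamma_norm km)[r0 xx xx'].
by case: (scale_mul_inv (lt0r_neq0 r0) xx xx').
Qed.

Lemma Gamma_star k x : (0 < k <= m)%N -> Gamma k x -> Gamma k (cl_star x).
Proof.
move=> km; have km' := andP km; elim=> {x} [x Vx x0||x y _ Gx _ Gy|x Gx Gx'].
- by rewrite (cl_star_Vsp _ Vx); [apply: Gamma_vec|case: km'].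
- by rewrite cl_star1; apply: Gamma_one.
- by rewrite cl_starM; apply: Gamma_mul.
- by rewrite cl_starV ?(Gamma_unit km) //; apply: Gamma_inv.
Qed.

Lemma Gamma_opp k x : (0 < k <= m)%N -> Gamma k x -> Gamma k (- x).
Proof.
move=> /andP[k0 _] Gx; rewrite -mulN1r; apply: Gamma_mul => //; apply: Gamma_vec.
  exact/VspN/Vsp1.
by rewrite oppr_eq0 oner_eq0.
Qed.

(** For a vector x, x^* = x and this is [Vsp_sandwich]; products compose. Allowing l > k lets
    Gamma_n act on V_{n+1}. *)
Lemma Vsp_Gamma_conj k l x w : (0 < k <= l)%N -> (l <= m)%N -> Gamma k x -> Vsp l w ->
  Vsp l (x * w * cl_star x).
Proof.
move=> /andP[k0 kl] lm Gx.
have km : (0 < k <= m)%N by rewrite k0 (leq_trans kl).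
have lm' : (0 < l <= m)%N by rewrite (leq_trans k0).
(* The claim for x^-1 is carried along so that the induction passes the constructor [Gamma_inv]. *)
suff [/(_ w)] : (forall w, Vsp l w -> Vsp l (x * w * cl_star x)) /\
  (forall w, Vsp l w -> Vsp l (x^-1 * w * cl_star x^-1)) by [].
elim: Gx => {x w} [x Vx x0||x y Gx [IHx IHx'] Gy [IHy IHy']|x Gx [IH IH']].
- have Vx' := VspW kl Vx; have Vxi : Vsp l x^-1.
    have [_ ->] := Vsp_inv lm' Vx' x0.
    by apply: VspZ; apply: Vsp_bar.
  by split=> w Vw; rewrite (cl_star_Vsp lm) //; apply: Vsp_sandwich.
- by rewrite invr1 cl_star1; split=> w; rewrite mul1r mulr1.
- rewrite invrM ?(Gamma_unit km) // !cl_starM; split=> w Vw.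
    by have := IHx _ (IHy _ Vw); rewrite !mulrA.
  by have := IHy' _ (IHx' _ Vw); rewrite !mulrA.
- by rewrite invrK.
Qed.

(** i_k lies outside C_k and anticommutes with i_1, ..., i_{k-1}; moving it across x flips the sign
    of each generator in x, which is [cl_prime]. *)
Lemma gen_Gamma k x : (0 < k < m)%N -> Gamma k x ->
  cl_gen R m k * x = cl_prime x * cl_gen R m k.
Proof.
move=> km; have km' : (0 < k <= m)%N by case/andP: km => -> /ltnW.
elim=> {x} [x Vx x0||x y _ IHx _ IHy|x Gx IHx].
- have {x0} : Vsp k x by []; case: Vx => s -> _; rewrite linear_sum mulr_sumr mulr_suml.
  apply: eq_bigr => -[[|j] jk] _; rewrite linearZ /= -scalerAl -scalerAr.
    by rewrite cl_gen0 cl_prime1 mulr1 mul1r.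
  have jm : (0 < j.+1 < m)%N by rewrite (ltn_trans jk) //; case/andP: km.
  by rewrite cl_prime_gen // cl_gen_anticomm ?mulNr // gtn_eqF.
- by rewrite cl_prime1 mulr1 mul1r.
- by rewrite cl_primeM mulrA IHx -mulrA IHy mulrA.
- have xU := Gamma_unit km' Gx.
  have pU : cl_prime x \is a GRing.unit.
    by apply/unitrP; exists (cl_prime x^-1); rewrite -!cl_primeM mulVr ?divrr ?cl_prime1.
  rewrite cl_primeV //; apply: (mulrI pU); rewrite mulrA -IHx.
  by rewrite mulrA divrr // mul1r -mulrA divrr // mulr1.
Qed.

Lemma Gamma_conj_gen k x : (0 < k < m)%N -> Gamma k x ->
  x * cl_gen R m k * cl_star x = normsq x *: cl_gen R m k.
Proof.
move=> km Gx; have km' : (0 < k <= m)%N by case/andP: km => -> /ltnW.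
rewrite -mulrA gen_Gamma //; last exact: Gamma_star.
by rewrite cl_prime_star mulrA; have [_ -> _] := Gamma_norm km' Gx; rewrite mulr_algl.
Qed.

(** Split w = v + t i_k with v in V_k: the conjugate of v stays in V_k and has no i_k coordinate,
    while i_k is only scaled. *)
Lemma coord_Gamma_conj k x w : (0 < k < m)%N -> Gamma k x -> Vsp k.+1 w ->
  cl_coord k (x * w * cl_star x) = normsq x * cl_coord k w.
Proof.
move=> km Gx Vw; have [k0 km1] := andP km.
have Vv := Vsp_recr km1 Vw; set t := cl_coord k w in Vv *; set v := w - _ in Vv.
have -> : w = v + t *: cl_gen R m k by rewrite subrK.
rewrite mulrDr mulrDl linearD /= -scalerAr -scalerAl Gamma_conj_gen //.
rewrite (@Vsp_coord_out _ _ k k) ?leqnn //; last first.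
  by apply: Vsp_Gamma_conj Gx Vv; rewrite ?k0 ?leqnn // ltnW.
by rewrite !linearZ /= cl_coord_gen // eqxx mulr1 add0r mulrC.
Qed.

Lemma Vsqn_Gamma_conj k l x w : (0 < k <= l)%N -> (l <= m)%N -> Gamma k x -> Vsp l w ->
  Vsqn l (x * w * cl_star x) = normsq x ^+ 2 * Vsqn l w.
Proof.
move=> kl lm Gx Vw; have [k0 kl1] := andP kl.
have lm' : (0 < l <= m)%N by rewrite (leq_trans k0).
have km : (0 < k <= m)%N by rewrite k0 (leq_trans kl1).
have [_ xx xx'] := Gamma_norm km Gx.
have := mul_bar_Vsp lm' (Vsp_Gamma_conj kl lm Gx Vw).
set s := Vsqn l (_ * _); rewrite !cl_barM cl_bar_star.
have sp : cl_star x * cl_prime x = (normsq x)%:A.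
  rewrite -[cl_star x]cl_primeK cl_prime_star -cl_primeM xx' linearZ /=.
  by rewrite cl_prime1.
rewrite !mulrA -[_ * cl_star x * _]mulrA sp mulr_algr -!scalerAl.
rewrite -[x * w * _]mulrA (mul_bar_Vsp lm' Vw) mulr_algr -!scalerAl xx !scalerA.
move=> /(congr1 (@cl_coord R m 0)); rewrite !linearZ /= cl_coord01 !mulr1 => <-.
by rewrite expr2 mulrAC.
Qed.

End CliffordGroup.

(** * Inverses in SL_2 and their Moebius action *)

Section SL2Inverse.
Variables (R : realType) (m k : nat).
Hypothesis km : (0 < k <= m)%N.
Local Notation C := (clifford R m).
Local Notation M2 := 'M[C]_2.
Implicit Types (g h : M2) (x : C).

Lemma SL2N g : SL2 k g -> SL2 k (- g).
Proof.
case=> Gg dt [V1 V2] [V3 V4]; split.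
- move=> i j; rewrite mxE; case: (Gg i j) => [G|->]; last by right; rewrite oppr0.
  by left; apply: Gamma_opp.
- by rewrite !mxE !linearN /= !mulNr !mulrN !opprK.
- by rewrite !mxE !linearN /= !mulrNN.
- by rewrite !mxE !linearN /= !mulrNN.
Qed.

(** The adjugate of a 2 by 2 matrix, twisted by [cl_star]. *)
Definition SL2_inv g : M2 :=
  \matrix_(i, j) if i == 0 then (if j == 0 then cl_star (g 1 1) else - cl_star (g 0 1))
                 else (if j == 0 then - cl_star (g 1 0) else cl_star (g 0 0)).

Lemma SL2_inv00 g : SL2_inv g 0 0 = cl_star (g 1 1). Proof. by rewrite mxE. Qed.
Lemma SL2_inv10 g : SL2_inv g 1 0 = - cl_star (g 1 0). Proof. by rewrite mxE. Qed.

Lemma SL2_Gamma10 g : SL2 k g -> g 1 0 != 0 -> Gamma k (g 1 0).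
Proof. by case=> /(_ 1 0)[//|->]; rewrite eqxx. Qed.

Lemma cl_star_unit x : x \is a GRing.unit -> cl_star x \is a GRing.unit.
Proof.
by move=> xU; apply/unitrP; exists (cl_star x^-1); rewrite -!cl_starM divrr ?mulVr ?cl_star1.
Qed.

(** Multiply on the right by the unit c^*: as c d^* and c^* a are fixed by [cl_star], a^* d c^* =
    a^* c d^* = c^* a d^*, and the relation a d^* - b c^* = 1 finishes. *)
Lemma SL2_det_star g : SL2 k g -> g 1 0 != 0 ->
  cl_star (g 0 0) * g 1 1 - cl_star (g 1 0) * g 0 1 = 1.
Proof.
move=> Sg c0; have cU := Gamma_unit km (SL2_Gamma10 Sg c0).
have km1 : (k <= m)%N by case/andP: km.
case: Sg => _ /=; set a := g 0 0; set b := g 0 1; set c := g 1 0 in cU *; set d := g 1 1.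
move=> dt [V1 V2] [V3 V4].
have e2 : d * cl_star c = c * cl_star d
  by rewrite -[RHS](cl_star_Vsp km1 V2) cl_starM cl_starK.
have e3 : cl_star a * c = cl_star c * a
  by rewrite -[RHS](cl_star_Vsp km1 V3) cl_starM cl_starK.
apply: (mulIr (cl_star_unit cU)); rewrite mulrBl mul1r -!mulrA e2 [LHS]addrC.
rewrite (mulrA (cl_star a)) e3 -mulrA addrC -mulrBr dt mulr1 //.
Qed.

(** The diagonal entries of both products are the two determinant relations and their images under
    [cl_star]; the others vanish because a b^*, c d^*, c^* a, d^* b are fixed by [cl_star]. *)
Lemma mx_inverse_SL2_inv g : SL2 k g -> g 1 0 != 0 -> mx_inverse g (SL2_inv g).
Proof.
move=> Sg c0; have dt' := SL2_det_star Sg c0.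
have km1 : (k <= m)%N by case/andP: km.
case: Sg => _ /= dt [V1 V2] [V3 V4].
have f (v : C) : Vsp k v -> cl_star v = v by exact: (@cl_star_Vsp R m k v km1).
have I2 (i : 'I_2) : i = 0 \/ i = 1.
  by case: i => [[|[|]]] // ?; [left|right]; apply: val_inj.
have s1 := congr1 (@cl_star R m) dt; have s2 := congr1 (@cl_star R m) dt'.
rewrite linearB /= !cl_starM !cl_starK cl_star1 in s1.
rewrite linearB /= !cl_starM !cl_starK cl_star1 in s2.
have := (f _ V1, f _ V2, f _ V3, f _ V4); rewrite !cl_starM !cl_starK => -[[[e1 e2] e3] e4].
split; apply/matrixP => i j; rewrite mxE big_ord_recl big_ord_recl big_ord0 addr0 /=.
  have -> : lift ord0 ord0 = 1 :> 'I_2 by apply: val_inj.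
  by case: (I2 i) => ->; case: (I2 j) => ->;
    rewrite !mxE /= ?mulrN ?e1 ?e2 ?subrr // addrC ?subrr.
have -> : lift ord0 ord0 = 1 :> 'I_2 by apply: val_inj.
by case: (I2 i) => ->; case: (I2 j) => ->;
  rewrite !mxE /= ?mulNr ?e3 ?e4 ?subrr // addrC ?subrr.
Qed.

Lemma mx_inverse_uniq g h h' : mx_inverse g h -> mx_inverse g h' -> h = h'.
Proof. by case=> _ hg [gh' _]; rewrite -[h]mulmx1 -gh' mulmxA hg mul1mx. Qed.

Lemma mx_inverseN g h : mx_inverse g h -> mx_inverse (- g) (- h).
Proof. by case=> e1 e2; split; rewrite mulNmx mulmxN opprK. Qed.

Lemma proj_classesE (S : set M2) (G : set M2) g : proj_classes S G -> G g ->
  G = [set g; - g] /\ (S g \/ S (- g)).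
Proof.
case=> h Sh <- [->|->]; first by split; [|left].
by split; [rewrite opprK setUC|right; rewrite opprK].
Qed.

(** Inverting g and -g gives h and -h, which have the same Moebius map. *)
Lemma class_act_inv g h (X : set (option C)) : mx_inverse g h ->
  class_act (class_inv [set g; - g]) X = mobius h @` X.
Proof.
move=> gh; apply/seteqP; split=> y /=.
- case=> h' [g' Gg' g'h'] [x Xx <-]; exists x => //.
  case: Gg' g'h' => /= -> g'h'; first by rewrite (mx_inverse_uniq g'h' gh).
  by rewrite (mx_inverse_uniq g'h' (mx_inverseN gh)) mobiusN.
- by case=> x Xx <-; exists h; [exists g => //; left|exists x].
Qed.

Lemma mobius_SL2_inv_None g : SL2 k g -> g 1 0 != 0 ->
  mobius (SL2_inv g) None = Some (- ((g 1 0)^-1 * g 1 1)).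
Proof.
move=> Sg c0; have cU := Gamma_unit km (SL2_Gamma10 Sg c0); have sU := cl_star_unit cU.
have km1 : (k <= m)%N by case/andP: km.
rewrite /mobius SL2_inv00 SL2_inv10 oppr_eq0.
case: eqP => [e|_]; first by move: sU; rewrite e unitr0.
rewrite invrN mulrN; congr (Some (- _)).
case: Sg => _ /= _ [_ V2] _; have e2 := cl_star_Vsp km1 V2.
rewrite cl_starM cl_starK in e2.
by apply: (mulrI cU); apply: (mulIr sU); rewrite !mulrA mulrVK // divrr // mul1r e2.
Qed.

Lemma mobius_SL2_inv g x : SL2 k g -> g 1 0 != 0 ->
  let u := x - g 0 0 * (g 1 0)^-1 in u \is a GRing.unit ->
  mobius (SL2_inv g) (Some x) =
  Some (- ((g 1 0)^-1 * g 1 1) - (g 1 0)^-1 * u^-1 * cl_star (g 1 0)^-1).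
Proof.
move=> Sg c0 u uU; have cU := Gamma_unit km (SL2_Gamma10 Sg c0); have sU := cl_star_unit cU.
have := mx_inverse_SL2_inv Sg c0; case=> _ /matrixP/(_ 0 0).
have km1 : (k <= m)%N by case/andP: km.
rewrite !mxE big_ord_recl big_ord_recl big_ord0 addr0 /= !mxE /=.
have -> : lift ord0 ord0 = 1 :> 'I_2 by apply: val_inj.
move=> dt; have := mobius_SL2_inv_None Sg c0.
rewrite /mobius !SL2_inv00 !SL2_inv10 oppr_eq0.
case: eqP => [e|_]; first by move: sU; rewrite e unitr0.
case=> E; rewrite invrN mulrN in E.
case: Sg => _ /= _ _ [V3 _]; have e3 := cl_star_Vsp km1 V3.
rewrite cl_starM cl_starK in e3.
set a := g 0 0 in u uU dt e3 *; set b := g 0 1 in dt *.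
set c := g 1 0 in u uU dt e3 cU sU E *; set d := g 1 1 in dt E *.
(* The denominator factors through u because a^* c = c^* a. *)
have -> : - cl_star c * x + cl_star a = - cl_star c * u.
  by rewrite /u mulrBr [X in _ - X]mulNr opprK mulrA -e3 mulrK.
have scuU : - cl_star c * u \is a GRing.unit by rewrite unitrMl ?unitrN.
case: eqP => [e|_]; first by move: scuU; rewrite e unitr0.
congr Some; apply: (mulIr scuU); rewrite mulrVK //.
rewrite cl_starV // mulrBl -E !mulNr !mulrN opprK mulrA mulrVK //.
rewrite -!mulrA mulKr // mulVr // mulr1.
rewrite /u mulrBr -addrA; congr (_ + _).
(* What remains is - b^* = c^-1 - d^* a c^-1, the relation d^* a - b^* c = 1 multiplied by c^-1. *)
have {}dt : cl_star d * a + - cl_star b * c = 1 := dt.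
apply: (mulIr cU); rewrite opprK mulrDl mulVr // -dt [X in X + _]mulNr -!mulrA mulVr // mulr1.
by rewrite addrA addNr add0r.
Qed.

End SL2Inverse.

(** * The inversion x |-> - x^-1: its effect on norm and height *)

Section Inversion.
Variables (R : realType) (m : nat).
Local Notation C := (clifford R m).
Implicit Types x : C.

Lemma cl_coord0_bar x : cl_coord 0 (cl_bar x) = cl_coord 0 x.
Proof.
rewrite /cl_coord cl_barE /clifford_sign swapsAA.
suff -> : cl_gen_index m 0 = finset.set0 by rewrite cards0 mul1r.
by apply/setP=> a; rewrite !inE.
Qed.

Lemma cl_coord_bar j x : (0 < j < m)%N -> cl_coord j (cl_bar x) = - cl_coord j x.
Proof.
by move=> jm; rewrite /cl_coord cl_barE /clifford_sign swapsAA card_gen_index // mulN1r.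
Qed.

Lemma VsqnZ k (t : R) x : Vsqn k (t *: x) = t ^+ 2 * Vsqn k x.
Proof. by rewrite /Vsqn mulr_sumr; apply: eq_bigr => j _; rewrite linearZ /= exprMn. Qed.

Lemma Vsqn_bar k x : (k <= m)%N -> Vsqn k (cl_bar x) = Vsqn k x.
Proof.
move=> km; apply: eq_bigr => -[[|j] jk] _ /=; first by rewrite cl_coord0_bar.
by rewrite cl_coord_bar ?sqrrN //= (leq_trans jk).
Qed.

(** x^-1 = bar x / |x|^2 and [cl_bar] negates the coordinate of i_k; the minus sign thus keeps the
    height positive where it was. *)
Lemma Vsp_oppinv k x : (0 < k < m)%N -> Vsp k.+1 x -> x != 0 ->
  [/\ Vsp k.+1 (- x^-1), Vsqn k.+1 (- x^-1) = (Vsqn k.+1 x)^-1 &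
      cl_coord k (- x^-1) = cl_coord k x / Vsqn k.+1 x].
Proof.
move=> km Vx x0; have [k0 km1] := andP km.
have q0 := Vsqn_gt0 km1 Vx x0.
have [_ ->] := Vsp_inv (k := k.+1) km1 Vx x0; split.
- by apply/VspN/VspZ/Vsp_bar.
- rewrite -scalerN -scaleN1r !VsqnZ Vsqn_bar // sqrrN expr1n mul1r expr2 -mulrA.
  by rewrite mulVf ?mulr1 // gt_eqF.
- by rewrite linearN linearZ /= cl_coord_bar // mulrN opprK mulrC.
Qed.

Lemma Vsqn_subr_gen k (t : R) x : (k < m)%N ->
  Vsqn k.+1 (x - t *: cl_gen R m k) = Vsqn k.+1 x - 2 * t * cl_coord k x + t ^+ 2.
Proof.
move=> km; have cE j : (j < m)%N ->
    cl_coord j (x - t *: cl_gen R m k) = cl_coord j x - t * (j == k)%:R.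
  by move=> jm; rewrite linearB [X in _ - X]linearZ /= cl_coord_gen.
rewrite /Vsqn !big_ord_recr /= cE // eqxx mulr1.
rewrite (eq_bigr (fun j : 'I_k => cl_coord j x ^+ 2)) => [|j _]; last first.
  by have jk := ltn_ord j; rewrite cE ?(ltn_trans jk) // ltn_eqF // mulr0 subr0.
by ring.
Qed.

Lemma normsqV k x : (0 < k <= m)%N -> Gamma k x -> normsq x^-1 = (normsq x)^-1.
Proof.
move=> km Gx; have [r0 xx xx'] := Gamma_norm km Gx; apply: normsqE.
rewrite (Gamma_invE km Gx) linearZ /= cl_barK -scalerAl -scalerAr xx' !scalerA.
by rewrite -mulrA mulVf ?mulr1 // gt_eqF.
Qed.

End Inversion.

(** * The image of the horosphere at infinity under g^-1 *)

Section Horosphere.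
Variables (R : realType) (n : nat).
Hypothesis n_gt0 : (0 < n)%N.
Local Notation C := (clifford R n.+1).
Variable g : 'M[C]_2.
Hypotheses (Sg : SL2 n g) (c0 : g 1 0 != 0).
Local Notation a := (g 0 0).
Local Notation b := (g 0 1).
Local Notation c := (g 1 0).
Local Notation d := (g 1 1).
Local Notation N := (normsq c).
Implicit Types x y : C.

Let nm : (0 < n <= n.+1)%N. Proof. by rewrite n_gt0 leqnSn. Qed.
Let nm1 : (0 < n < n.+1)%N. Proof. by rewrite n_gt0 leqnn. Qed.
Let Gc : Gamma n c. Proof. exact: (SL2_Gamma10 Sg c0). Qed.
Let cU : c \is a GRing.unit. Proof. exact: (Gamma_unit nm Gc). Qed.
Let N0 : 0 < N. Proof. by case: (Gamma_norm nm Gc). Qed.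

Lemma Vsp_ac : Vsp n (a / c).
Proof.
case: Sg => _ /= _ _ [V3 _]; have sU := cl_star_unit cU.
have := Vsp_Gamma_conj (l := n) _ (leqnSn n) (Gamma_inv (Gamma_star nm Gc)) V3.
rewrite n_gt0 leqnn => /(_ isT); rewrite cl_starV // cl_starK mulrA mulVr //.
by rewrite mul1r.
Qed.

Lemma Vsp_cd : Vsp n (c^-1 * d).
Proof.
case: Sg => _ /= _ [_ V2] _; have sU := cl_star_unit cU.
have := Vsp_Gamma_conj (l := n) _ (leqnSn n) (Gamma_inv Gc) V2.
have := cl_star_Vsp (leqnSn n) V2; rewrite cl_starM cl_starK => <-.
by rewrite n_gt0 leqnn => /(_ isT); rewrite cl_starV // mulrA mulrK.
Qed.

(** The coefficient of i_n is also the radius: the sphere is tangent to V_n at - c^-1 d =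
    g^-1(oo). *)
Definition horocenter : C := - (c^-1 * d) + (2 * N)^-1 *: cl_gen R n.+1 n.

Lemma horocenterE : (normsq c)^-1 *:
    (- (cl_bar c * d) - (2^-1 *: cl_gen R n.+1 n) * (cl_star c * b - cl_star a * d))
  = horocenter.
Proof.
have -> : cl_star c * b - cl_star a * d = -1.
  by rewrite -(SL2_det_star nm Sg c0) opprB.
rewrite mulrN1 opprK scalerDr scalerN scalerAl -(Gamma_invE nm Gc) scalerA.
by rewrite /horocenter invfM [_^-1 * 2^-1]mulrC.
Qed.

Lemma Vsp_horocenter : Vsp n.+1 horocenter.
Proof.
apply: VspD; first exact: VspN (VspW (leqnSn n) Vsp_cd).
by apply: VspZ; apply: Vsp_gen.
Qed.

(** With r = 1/(2N), expanding |w - r i_n|^2 = r^2 cancels r^2 and leaves |w|^2 = w_n / N. *)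
Lemma horosphereP y : Vsp n.+1 y ->
  euclidean_sphere horocenter (2 * N)^-1 y <->
  N * Vsqn n.+1 (y + c^-1 * d) = cl_coord n (y + c^-1 * d).
Proof.
move=> Vy; set w := y + _.
have -> : euclidean_sphere horocenter (2 * N)^-1 y <->
    Vsqn n.+1 (w - (2 * N)^-1 *: cl_gen R n.+1 n) = (2 * N)^-1 ^+ 2.
  have -> : w - (2 * N)^-1 *: cl_gen R n.+1 n = y - horocenter.
    by rewrite opprD opprK addrA.
  have r0 : 0 <= (2 * N)^-1 by rewrite invr_ge0 mulr_ge0 // ltW.
  split=> [[_ <-]|E]; first by rewrite sqr_sqrtr // Vsqn_ge0.
  by split=> //; rewrite /Vnorm -/(Vsqn _ _) E sqrtr_sqr ger0_norm.
rewrite Vsqn_subr_gen //; have N1 : N != 0 by rewrite gt_eqF.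
have -> : 2 * (2 * N)^-1 * cl_coord n w = N^-1 * cl_coord n w.
  by rewrite invfM mulrA divff ?mul1r ?pnatr_eq0.
split=> [/(canRL (addrK _))|<-]; last by rewrite mulKf // subrr add0r.
by rewrite subrr => /eqP; rewrite subr_eq0 => /eqP ->; rewrite mulVKf.
Qed.

Lemma cl_coord_cd y : cl_coord n (y + c^-1 * d) = cl_coord n y.
Proof. by rewrite linearD /= (Vsp_coord_out _ Vsp_cd) ?addr0 // !leqnn. Qed.

Lemma mobius_inv_S_infty x : S_infty R n x ->
  exists2 y, mobius (SL2_inv g) (Some x) = Some y &
    (euclidean_sphere horocenter (2 * N)^-1 `&` upper_half R n) y.
Proof.
move=> [Vx x1]; pose u := x - a / c.
have Vu : Vsp n.+1 u by apply: VspB => //; apply: VspW Vsp_ac.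
have u1 : cl_coord n u = 1.
  by rewrite linearB /= x1 (Vsp_coord_out _ Vsp_ac) ?subr0 // !leqnn.
(* Height 1 keeps u away from 0, so x is not the pole a c^-1 and its image is finite. *)
have u0 : u != 0 by apply: contra_eq_neq u1 => ->; rewrite linear0 eq_sym oner_eq0.
have [uU _] := Vsp_inv (k := n.+1) (leqnn _) Vu u0.
have [Vi qi ci] := Vsp_oppinv nm1 Vu u0.
have q0 := Vsqn_gt0 (leqnn _) Vu u0.
pose w := c^-1 * (- u^-1) * cl_star c^-1; exists (- (c^-1 * d) + w).
  by rewrite (mobius_SL2_inv nm Sg c0 uU) /w mulrN mulNr.
have Gi := Gamma_inv Gc; have nn : (0 < n <= n.+1)%N by rewrite n_gt0 leqnSn.
have Vw : Vsp n.+1 w by apply: Vsp_Gamma_conj Gi Vi.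
have wn : cl_coord n w = N^-1 / Vsqn n.+1 u.
  by rewrite coord_Gamma_conj // ci u1 mul1r (normsqV nm Gc).
have wq : Vsqn n.+1 w = N^-1 ^+ 2 / Vsqn n.+1 u.
  by rewrite (Vsqn_Gamma_conj nn (leqnn _) Gi Vi) qi (normsqV nm Gc).
have Vy : Vsp n.+1 (- (c^-1 * d) + w).
  by apply: VspD => //; apply/VspN/(VspW (leqnSn n))/Vsp_cd.
have yw : - (c^-1 * d) + w + c^-1 * d = w by rewrite addrAC addNr add0r.
split.
  apply/horosphereP => //; rewrite yw wq wn expr2 !mulrA divff ?mul1r //.
  by rewrite gt_eqF.
split=> //; rewrite -cl_coord_cd yw wn; apply: mulr_gt0; rewrite invr_gt0 //.
Qed.

Lemma horosphere_mobius_inv y : euclidean_sphere horocenter (2 * N)^-1 y ->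
  y + c^-1 * d != 0 ->
  exists2 x, S_infty R n x & mobius (SL2_inv g) (Some x) = Some y.
Proof.
move=> Sy; have Vy := proj1 Sy; move/(horosphereP Vy): Sy.
set w := y + _ => wE w0.
have Vw : Vsp n.+1 w by apply: VspD => //; apply: VspW Vsp_cd.
have nn : (0 < n <= n.+1)%N by rewrite n_gt0 leqnSn.
(* Solving w = - c^-1 u^-1 (c^-1)^* for u = x - a c^-1 gives u = - v^-1. *)
pose v := c * w * cl_star c.
have Vv : Vsp n.+1 v by apply: Vsp_Gamma_conj Gc Vw.
have vn : cl_coord n v = N * cl_coord n w by rewrite coord_Gamma_conj.
have vq : Vsqn n.+1 v = N ^+ 2 * Vsqn n.+1 w by rewrite (Vsqn_Gamma_conj nn).
have q0 := Vsqn_gt0 (leqnn _) Vw w0; have sU := cl_star_unit cU.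
have [wU _] := Vsp_inv (k := n.+1) (leqnn _) Vw w0.
have vU : v \is a GRing.unit by rewrite !unitrMl.
have v0 : v != 0 by apply: contraTneq vU => ->; rewrite unitr0.
have [Vu _ un] := Vsp_oppinv nm1 Vv v0.
pose x := - v^-1 + a / c; exists x.
  split; first by apply: VspD => //; apply: VspW Vsp_ac.
  (* The height of x is N w_n / (N^2 |w|^2), which is 1 by N |w|^2 = w_n. *)
  rewrite linearD /= (Vsp_coord_out _ Vsp_ac) ?leqnn // addr0 un vn vq -wE.
  by rewrite mulrA -expr2 divff // mulf_neq0 ?expf_neq0 // gt_eqF.
have xu : x - a / c = - v^-1 by rewrite addrK.
rewrite (mobius_SL2_inv nm Sg c0) xu ?unitrN ?unitrV // invrN invrK mulrN mulNr opprK.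
rewrite /v cl_starV // !mulrA mulVr // mul1r mulrK //.
by rewrite addrC addrK.
Qed.

Lemma horosphere_base : euclidean_sphere horocenter (2 * N)^-1 (- (c^-1 * d)).
Proof.
have V := VspW (leqnSn n) (VspN Vsp_cd); apply/horosphereP => //.
by rewrite addNr /Vsqn big1 ?mulr0 ?linear0 // => j _; rewrite linear0 expr0n.
Qed.

Lemma mobius_inv_image :
  mobius (SL2_inv g) @` (Some @` S_infty R n) =
  Some @` (euclidean_sphere horocenter (2 * N)^-1 `&` upper_half R n).
Proof.
apply/seteqP; split=> [_ [_ [x Sx <-] <-]|_ [y [Sy [Vy yn]] <-]].
  by have [y -> Sy] := mobius_inv_S_infty Sx; exists y.
have [|x Sx xy] := horosphere_mobius_inv Sy; last by exists (Some x) => //; exists x.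
(* The point w = 0 has height 0, so the half-space excludes it. *)
by apply: contraTneq yn => e; rewrite -cl_coord_cd e linear0 ltxx.
Qed.

Lemma mobius_inv_image_infty :
  mobius (SL2_inv g) @` (Some @` S_infty R n `|` [set None]) =
  Some @` euclidean_sphere horocenter (2 * N)^-1.
Proof.
have E0 := mobius_SL2_inv_None nm Sg c0.
apply/seteqP; split=> [_ [_ [[x Sx <-]|->] <-]|_ [y Sy <-]].
- by have [y -> [Sy _]] := mobius_inv_S_infty Sx; exists y.
- by rewrite E0; exists (- (c^-1 * d)) => //; apply: horosphere_base.
- have [/eqP e|w0] := boolP (y + c^-1 * d == 0).
    (* The tangency point is the image of oo. *)
    by exists None; [right|rewrite E0; congr Some; apply/esym/eqP; rewrite -addr_eq0 e].
  have [x Sx xy] := horosphere_mobius_inv Sy w0.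
  by exists (Some x) => //; left; exists x.
Qed.

End Horosphere.

(** * Coefficients of elements of K, and rationality of |x|^2 *)

Section RationalForm.
Variables (R : realType) (m k : nat) (ds : nat -> nat).
Hypothesis km : (k <= m)%N.
Local Notation C := (clifford R m).
Local Notation I := {set 'I_m.-1}.
Implicit Types x y : C.

Lemma Kalg_bar x : Kalg k ds x -> Kalg k ds (cl_bar x).
Proof.
elim=> {x} [q|j jk|x y _ Kx _ Ky|x y _ Kx _ Ky].
- by rewrite linearZ /= cl_bar1; apply: Kalg_rat.
- rewrite linearZ /= cl_bar_gen; last first.
    by case/andP: jk => -> jk; rewrite (leq_trans jk).
  rewrite scalerN -scaleN1r -mulr_algl -[-1](rmorphN1 (ratr : rat -> R)).
  by apply: Kalg_mul; [apply: Kalg_rat|apply: Kalg_gen].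
- by rewrite linearD; apply: Kalg_add.
- by rewrite cl_barM; apply: Kalg_mul.
Qed.

(** The irrational factor carried by e_A in K; index a stands for i_{a+1}, hence [ds a.+1]. *)
Definition sqrt_prod (A : I) : R := \prod_(a in A) Num.sqrt (ds a.+1)%:R.

(** Common factors pair up to sqrt(d)^2 = d, which is rational; the unpaired ones run over the
    symmetric difference, just as in e_A e_B. *)
Lemma sqrt_prodM A B : sqrt_prod A * sqrt_prod B =
  ratr (\prod_(a in A :&: B) (ds a.+1)%:R) * sqrt_prod (symdiff A B).
Proof.
rewrite /sqrt_prod rmorph_prod /=.
rewrite [X in X * _ = _]big_mkcond [X in _ * X = _]big_mkcond.
rewrite [X in _ = X * _]big_mkcond [X in _ = _ * X]big_mkcond -!big_split /=.
apply: eq_bigr => a _; rewrite in_symdiff finset.in_setI.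
case: (a \in A); case: (a \in B); rewrite /= ?mulr1 ?mul1r //.
by rewrite -expr2 sqr_sqrtr ?ler0n // ratr_nat.
Qed.

Lemma Kalg_coef x : Kalg k ds x ->
  forall A, exists q : rat, x A = ratr q * sqrt_prod A.
Proof.
have r0 : ratr 0 = 0 :> R by apply: rmorph0.
elim=> {x} [q|j jk|x y _ Kx _ Ky|x y _ Kx _ Ky] A.
- rewrite !ffunE /=; case: eqP => [->|_].
    by exists q; rewrite /sqrt_prod big_set0.
  by exists 0; rewrite r0 mul0r; apply: mulr0.
- rewrite !ffunE /=; case: eqP => [->|_]; last by exists 0; rewrite r0 mul0r; apply: mulr0.
  exists 1; rewrite [ratr 1]rmorph1 mul1r; case: j jk => // j /= jk.
  have jm : (j < m.-1)%N by rewrite -ltnS (leq_trans jk) // (leq_trans km) // leqSpred.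
  rewrite (cl_gen_indexE (Ordinal jm)) /sqrt_prod big_set1; exact: mulr1.
- rewrite ffunE; have [p ->] := Kx A; have [q ->] := Ky A.
  by exists (p + q); rewrite rmorphD mulrDl.
- rewrite clifford_mulE; elim/big_ind: _ => [|u v [p ->] [q ->]|B _].
  + by exists 0; rewrite r0 mul0r.
  + by exists (p + q); rewrite rmorphD mulrDl.
  + have [p ->] := Kx B; have [q ->] := Ky (symdiff B A).
    rewrite mulrACA sqrt_prodM symdiffK !mulrA.
    exists ((-1) ^+ swaps B (symdiff B A) * p * q *
            \prod_(a in B :&: symdiff B A) (ds a.+1)%:R).
    by rewrite !rmorphM rmorphXn rmorphN1 -!mulrA.
Qed.

(** x bar x lies in K, and on its coefficient at 1 the product of square roots is empty. *)
Lemma Kalg_normsq_rat x : Kalg k ds x -> exists q : rat, normsq x = ratr q.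
Proof.
move=> Kx; have [q E] := Kalg_coef (Kalg_mul Kx (Kalg_bar Kx)) (cl_gen_index m 0).
exists q; rewrite /normsq /cl_coord E /sqrt_prod big1 ?mulr1 // => a.
by rewrite inE.
Qed.

End RationalForm.

(** In lowest terms, the denominator divides the r-th power of the numerator, to which it is
    coprime. *)
Lemma rat_int_root (q : rat) r : (0 < r)%N -> q ^+ r \is a Num.int -> q \is a Num.int.
Proof.
move=> r0 /intrP[z qz].
have dn : (denq q)%:~R != 0 :> rat by rewrite intr_eq0 denq_neq0.
have E : numq q ^+ r = z * denq q ^+ r.
  apply/eqP; rewrite -(eqr_int rat) rmorphM !rmorphXn /= -qz -exprMn.
  by rewrite -{2}[q]divq_num_den divfK.
have : (denq q %| numq q ^+ r)%Z by rewrite E dvdz_mull // dvdz_exp.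
have cop : coprimez (denq q) (numq q ^+ r).
  by rewrite coprimez_pexpr // coprimez_sym; apply: coprime_num_den.
rewrite -[X in (_ %| X)%Z]mulr1 Gauss_dvdzr // => d1.
by rewrite Qint_def; move: d1 (denq_gt0 q); case: (denq q) => // -[|[|]].
Qed.

(** * Integrality of |c|^2 for c in an order *)

Section Order.
Variables (R : realType) (m k : nat) (ds : nat -> nat).
Hypothesis km : (k <= m)%N.
Local Notation C := (clifford R m).
Implicit Types x y : C.

Section Combination.
Variables (r : nat) (b : 'I_r -> C).

Definition rcomb (v : 'rV[rat]_r) : C := \sum_j ratr (v 0 j) *: b j.

(** Row i of [M] holds the coordinates of f (b_i), so f is right multiplication by [M] and
    composites read from left to right. *)
Lemma rcomb_mulmx (f : C -> C) (M : 'M[rat]_r) :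
  linear f -> (forall i, f (b i) = rcomb (row i M)) ->
  forall v, f (rcomb v) = rcomb (v *m M).
Proof.
move=> f_linear fb v.
pose F : {linear C -> C} := HB.pack f (GRing.isLinear.Build R C C *:%R f f_linear).
have fZ (t : R) x : f (t *: x) = t *: f x by apply: (linearZZ F).
have -> : f (rcomb v) = \sum_j f (ratr (v 0 j) *: b j) by apply: (linear_sum F).
under eq_bigr => i _ do rewrite fZ fb scaler_sumr.
rewrite exchange_big /=; apply: eq_bigr => j _.
rewrite mxE rmorph_sum /= scaler_suml; apply: eq_bigr => i _.
by rewrite mxE rmorphM scalerA.
Qed.

Lemma rcomb_inj :
  (forall q : 'I_r -> rat, \sum_i ratr (q i) *: b i = 0 -> forall i, q i = 0) ->
  injective rcomb.
Proof.
move=> free v w E; apply/rowP => i; apply/eqP; rewrite -subr_eq0; apply/eqP.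
apply: (free (fun i => v 0 i - w 0 i)).
under eq_bigr => j _ do rewrite rmorphB scalerBl.
by rewrite sumrB; apply/eqP; rewrite subr_eq0; apply/eqP.
Qed.

End Combination.

(* With L and R the left and right multiplications by c, which have integral
   matrices on a basis of O, the identity L . bar . R . bar = |c|^2 on K gives
   |c|^(2 dim K) = det L det R, since bar is an involution of K. *)
Lemma order_normsq_int (O : set C) c : is_order (Kalg k ds) O -> O c ->
  c * cl_bar c = (normsq c)%:A -> normsq c \is a Num.int.
Proof.
case=> O1 OB OM [r [b [free KE OE]]] Oc cN.
have Ob i : O (b i).
  rewrite OE; exists (fun j => (j == i)%:R); rewrite (bigD1 i) //= eqxx mulr1z.
  by rewrite big1 ?addr0 // => j /negPf ->; rewrite mulr0z.
have OK x : O x -> Kalg k ds x.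
  rewrite OE KE => -[z ->]; exists (fun i => (z i)%:~R); apply: eq_bigr => i _.
  by rewrite ratr_int scaler_int.
(* A positive exponent is required by [rat_int_root]; it comes from 1 being a nonzero element of
   O. *)
have r_gt0 : (0 < r)%N.
  rewrite lt0n; apply/eqP => r0; move: O1; rewrite OE => -[z /eqP]; subst r.
  by rewrite big_ord0 oner_eq0.
have [q qE] := Kalg_normsq_rat km (OK _ Oc).
have intM x : O x -> exists z : 'rV[int]_r, x = rcomb b (map_mx intr z).
  rewrite OE => -[z ->]; exists (\row_i z i); apply: eq_bigr => i _.
  by rewrite !mxE ratr_int scaler_int.
have /choice[ML hL] i := intM _ (OM _ _ Oc (Ob i)).
have /choice[MR hR] i := intM _ (OM _ _ (Ob i) Oc).
(* [cl_bar] maps O into K but is not assumed to preserve O, so these coordinates are only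
   rational. *)
have ratM i : exists v : 'rV[rat]_r, cl_bar (b i) = rcomb b v.
  have := Kalg_bar km (OK _ (Ob i)); rewrite KE => -[v ->]; exists (\row_i v i).
  by apply: eq_bigr => j _; rewrite mxE.
have /choice[MS hS] := ratM.
pose L := \matrix_i ML i; pose Rm := \matrix_i MR i; pose S := \matrix_i MS i.
have inj := rcomb_inj free.
have barE v : cl_bar (rcomb b v) = rcomb b (v *m S).
  apply: (rcomb_mulmx (@cl_bar_is_linear R m)) => i.
  by rewrite rowK hS.
have LE v : c * rcomb b v = rcomb b (v *m map_mx intr L).
  apply: (rcomb_mulmx (f := *%R c)) => [t x y|i]; first by rewrite mulrDr scalerAr.
  by rewrite -map_row rowK hL.
have RE v : rcomb b v * c = rcomb b (v *m map_mx intr Rm).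
  apply: (rcomb_mulmx (f := *%R^~ c)) => [t x y|i]; first by rewrite mulrDl scalerAl.
  by rewrite -map_row rowK hR.
have SS : S *m S = 1%:M.
  apply/row_matrixP => i; rewrite !rowE mulmxA mulmx1; apply: inj.
  by rewrite -!barE cl_barK.
(* Read left to right: x, bar x, (bar x) c, (bar c) x, c (bar c) x = |c|^2 x. *)
have LR : S *m map_mx intr Rm *m S *m map_mx intr L = q%:M.
  apply/row_matrixP => i; rewrite !rowE !mulmxA; apply: inj.
  rewrite -LE -barE -RE -barE cl_barM cl_barK mulrA cN qE mulr_algl mul_mx_scalar.
  rewrite /rcomb scaler_sumr; apply: eq_bigr => j _.
  by rewrite scalerA -rmorphM [in RHS]mxE.
have qr : q ^+ r = (\det Rm * \det L)%:~R.
  rewrite -det_scalar -LR !det_mulmx !det_map_mx rmorphM /=.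
  (* The rational matrix [S] enters twice and (det S)^2 = 1, so it drops out of the determinant. *)
  have := congr1 determinant SS; rewrite det_mulmx det1.
  by move: (\det S) => s ss; rewrite [s * _ * s]mulrAC ss mul1r.
rewrite qE; have /intrP[z ->] : q \is a Num.int.
  by apply: (rat_int_root r_gt0); rewrite qr intr_int.
by rewrite ratr_int intr_int.
Qed.

End Order.

(** The sphere meets the boundary only at g^-1(oo). Hence two image identities: S_infty alone gives
    the part in the half-space, and adjoining oo gives the full sphere. *)
Theorem mainTheorem2 (R : realType) (n : nat) (n_gt0 : (0 < n)%N)
    (G : set 'M[clifford R n.+1]_2) (hG : PSL2 n G)
    (g : 'M[clifford R n.+1]_2) (hg : G g) (hc : g 1 0 != 0) :
  let a := g 0 0 in let b := g 0 1 in let c := g 1 0 in let d := g 1 1 in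
  let p := (normsq c)^-1 *:
    (- (cl_bar c * d) - (2^-1 *: cl_gen R n.+1 n) * (cl_star c * b - cl_star a * d)) in
  let r := (2 * normsq c)^-1 in
  [/\ Vsp n.+1 p,
      0 < r,
      class_act (class_inv G) (Some @` S_infty R n) =
        Some @` (euclidean_sphere p r `&` upper_half R n),
      class_act (class_inv G) (Some @` S_infty R n `|` [set None]) =
        Some @` euclidean_sphere p r &
      forall (ds : nat -> nat) (O : set (clifford R n.+1)),
        (forall j, (0 < j < n)%N -> (0 < ds j)%N /\ squarefree (ds j)) ->
        primitive_form n ds ->
        is_order (Kalg n ds) O ->
        (forall x, O x -> O (cl_star x)) ->
        PSL2_order n O G ->
        r^-1 \is a Num.int].
Proof.
have nm : (0 < n <= n.+1)%N by rewrite n_gt0 leqnSn.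
have [GE Sg'] := proj_classesE hG hg.
have Sg : SL2 n g by case: Sg' => // /(SL2N nm); rewrite opprK.
have [N0 cN _] := Gamma_norm nm (SL2_Gamma10 Sg hc).
have gh := mx_inverse_SL2_inv nm Sg hc.
move=> a b c d; rewrite (horocenterE n_gt0 Sg hc); split.
- exact: Vsp_horocenter.
- by rewrite invr_gt0 mulr_gt0.
- by rewrite GE (class_act_inv _ gh) mobius_inv_image.
- by rewrite GE (class_act_inv _ gh) mobius_inv_image_infty.
- move=> ds O _ _ Oord _ hO; rewrite invrK rpredM ?rpred_nat //.
  have [_ OSg] := proj_classesE hO hg; have [O1 OB _ _] := Oord.
  have O0 : O 0 by rewrite -(subrr (1 : clifford R n.+1)); apply: OB.
  (* The class only says that g or -g has entries in O; either way c lies in O. *)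
  have Oc : O c.
    case: OSg => -[_ /(_ 1 0)] //; rewrite mxE => ON _.
    by rewrite -[c]opprK -sub0r; apply: OB.
  exact: (order_normsq_int (leqnSn n) Oord Oc cN).
Qed.
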